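(* Let $l\ge1$, let $x=(x_1,\dots,x_l)$ be an $l$-dimensional box (an array of positive integers) and let $1^l=(1,\dots,1)$ be the unit box. Consider the aggregation of boxes $x+1^l\to z$. Then: (1) The total number of ways for the particle $1^l$ to attach to the box $x$ is $$|T|=\prod_{i=1}^{l}(x_i+2)-\prod_{i=1}^{l}x_i.$$ (2) Each result of aggregation $x+1^l\to z$ is of the form $z=x+e_{i_1}+\dots+e_{i_k}$ with $1\le i_1<\dots<i_k\le l$ and $1\le k\le l$, where $e_i$ is the $i$-th standard basis vector. The transitional probabilities are $$P_{x,1^l}^{\,x+e_{i_1}+\dots+e_{i_k}}=\frac{2^k\,x_1\cdots x_l}{x_{i_1}\cdots x_{i_k}\,|T|}.$$ (3) The probability that the resulting box grows in size by $1$ in (exactly) $k$ directions, $k=1,2,\dots,l$, is $$P(X=k)=\frac{2^k\,E_{l-k}(x_1,\dots,x_l)}{|T|}.$$ (4) On average, through the aggregation with a particle, a box $x$ grows in size in $M$ directions, where $$M=\frac{\sum_{i=1}^{l}\frac{2}{2+x_i}}{1-\prod_{i=1}^{l}\frac{x_i}{x_i+2}}.$$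
   Context: An $l$-dimensional box $x=(x_1,\dots,x_l)\in\mathbb{Z}_{>0}^l$ is a Cartesian product of $l$ intervals parallel to the coordinate axes of $\mathbb{R}^l$, with integer side lengths $x_1,\dots,x_l$ (in this order) and with vertices in $\mathbb{Z}^l$. Attachments of boxes $x$ and $y$: keep the box $x$ in a fixed position and translate the box $y$ (without rotation) by lattice vectors. A position of $y$ is an attachment if the two boxes are placed next to each other (disjoint interiors) and their boundaries have at least one common lattice point. The result of the aggregation is the box $z=(z_1,\dots,z_l)$ given by the side lengths of the minimal axis-aligned bounding box of the union; one writes $x+y\to z$. All attachments are assumed equally likely, and $P^{z}_{x,y}$ is the number of attachments with result $z$ divided by the total number $|T|$ of attachments. $X$ is the random variable assigning to a result $z$ the number of indices $i$ with $z_i\neq x_i$; $M$ in (4) is its expected value. $E_s(x_1,\dots,x_l)=\sum_{1\le i_1<\dots<i_s\le l}x_{i_1}\cdots x_{i_s}$ is the $s$-th elementary symmetric polynomial, $E_0=1$. *)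

(* Defs.v *)
From mathcomp Require Import all_boot all_order all_algebra finmap.
From mathcomp Require Import all_classical all_reals all_analysis.

Set Implicit Arguments.
Unset Strict Implicit.
Unset Printing Implicit Defensive.

Import Order.TTheory GRing.Theory Num.Theory.
Import numFieldNormedType.Exports.

Local Open Scope classical_set_scope.
Local Open Scope ring_scope.

(* A box is its row vector of side lengths, of type 'rV[nat]_l; positivity of
   the entries is a hypothesis of the statements. *)

Definition cuboid (R : realType) (l : nat) (u v : 'rV[R]_l) : set 'rV[R]_l :=
  [set p | forall i, u 0 i <= p 0 i <= v 0 i].

Definition lattice_point (R : realType) (l : nat) (a : 'rV[int]_l) : 'rV[R]_l :=
  map_mx intr a.

(* The box x, placed with its least vertex at the lattice point a. *)
Definition placed_box (R : realType) (l : nat) (a : 'rV[int]_l)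
    (x : 'rV[nat]_l) : set 'rV[R]_l :=
  cuboid (lattice_point R a) (lattice_point R a + map_mx (fun n => n%:R) x).
Arguments placed_box R {l} a x p.

Definition boundary (T : topologicalType) (A : set T) : set T :=
  closure A `\` A°.

(* x is kept at the origin and the positions of y are parametrised by its
   translation vector t. *)
Definition attachments (R : realType) (l : nat) (x y : 'rV[nat]_l) :
    set 'rV[int]_l :=
  [set t | (placed_box R 0 x)° `&` (placed_box R t y)° = set0 /\
           exists p : 'rV[int]_l,
             boundary (placed_box R 0 x) (lattice_point R p) /\
             boundary (placed_box R t y) (lattice_point R p)].

(* z gives the side lengths of the least axis-parallel box (with arbitrary real
   vertices allowed as competitors) containing both x and the translate of y. *)
Definition aggregates_to (R : realType) (l : nat) (x y : 'rV[nat]_l)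
    (t : 'rV[int]_l) (z : 'rV[nat]_l) : Prop :=
  exists a : 'rV[int]_l,
    placed_box R 0 x `|` placed_box R t y `<=` placed_box R a z /\
    forall u v : 'rV[R]_l,
      placed_box R 0 x `|` placed_box R t y `<=` cuboid u v ->
      placed_box R a z `<=` cuboid u v.

Definition results (R : realType) (l : nat) (x y : 'rV[nat]_l) :
    set 'rV[nat]_l :=
  [set z | exists2 t, attachments R x y t & aggregates_to R x y t z].

(* fset_set sends an infinite set to fset0, so that this is the cardinality of
   the set of attachments only when that set is finite. *)
Definition nb_attachments (R : realType) (l : nat) (x y : 'rV[nat]_l) : nat :=
  #|` fset_set (attachments R x y)|.

Definition transition_prob (R : realType) (l : nat) (x y z : 'rV[nat]_l) : R :=
  #|` fset_set (attachments R x y `&`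
                [set t | aggregates_to R x y t z])|%:R
  / (nb_attachments R x y)%:R.

Definition growth (l : nat) (x z : 'rV[nat]_l) : nat :=
  #|[set i : 'I_l | z 0 i != x 0 i]|.

Definition growth_prob (R : realType) (l : nat) (x y : 'rV[nat]_l) (k : nat) :
    R :=
  \sum_(z \in results R x y `&` [set z | growth x z = k])
     transition_prob R x y z.

Definition growth_mean (R : realType) (l : nat) (x y : 'rV[nat]_l) : R :=
  \sum_(z \in results R x y) (growth x z)%:R * transition_prob R x y z.

Definition esym_poly (l s : nat) (x : 'rV[nat]_l) : nat :=
  (\sum_(I : {set 'I_l} | #|I| == s) \prod_(i in I) x 0%R i)%N.

(* Main.v *)
(* The unit box attaches at t exactly when -1 <= t_i <= x_i for all i, with
   equality on one side for at least one i; the result is x + \sum_(i in I) e_i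
   where I is the set of the i with t_i = -1 or t_i = x_i.  Hence each I is the
   outcome of 2^#|I| \prod_(i \notin I) x_i positions, the term of index I in
   the expansion of \prod_i (2 + x_i); the term of the empty set counts the
   positions inside x.  In the mean, the terms with i \in I add up to
   2 \prod_(j != i) (2 + x_j). *)
Require Import Defs.
From mathcomp Require Import all_boot all_order all_algebra finmap.
From mathcomp Require Import all_classical all_reals all_analysis.
From mathcomp Require Import zify ring lra.

Import Order.TTheory GRing.Theory Num.Theory.
Import numFieldNormedType.Exports.

Local Open Scope classical_set_scope.
Local Open Scope ring_scope.

(** * Interior, closure and boundary of boxes *)

(** An interior point stays in the cuboid when moved by [e / 2] either way along a single
    coordinate, which makes both inequalities strict. *)
Lemma interior_cuboid (R : realType) (l : nat) (u v : 'rV[R]_l) :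
  (cuboid u v)° = [set p | forall i, u 0 i < p 0 i < v 0 i].
Proof.
apply/seteqP; split=> p /=.
  move=> /nbhs_ballP[e /= e0 sub] i.
  have near (q : 'rV[R]_l) : (forall j, `|p 0 j - q 0 j| < e) -> cuboid u v q.
    by move=> pq; apply: sub; split=> // a j; rewrite ord1; exact: pq.
  have ok s : `|s| < e ->
      cuboid u v (\row_j (p 0 j + (if j == i then s else 0))).
    move=> se; apply: near => j; rewrite mxE opprD addNKr normrN.
    by case: ifP => // _; rewrite normr0.
  have e2 : `|e / 2| < e by rewrite gtr0_norm; lra.
  have e2N : `|- (e / 2)| < e by rewrite normrN.
  have := ok _ e2 i; have := ok _ e2N i; rewrite !mxE eqxx.
  by move=> /andP[? _] /andP[_ ?]; apply/andP; split; lra.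
(* Products of neighbourhoods of the entries generate the neighbourhoods of a matrix. *)
move=> pin; exists (fun=> fun j => [set r | u 0 j <= r <= v 0 j]) => /=.
  move=> a j; rewrite ord1; apply: filterS (near_in_itvoo (pin j)) => r.
  by rewrite in_itv /= => /andP[/ltW ? /ltW ?]; apply/andP.
by move=> q /= qin i; exact: qin.
Qed.

Lemma closure_cuboid (R : realType) (l : nat) (u v : 'rV[R]_l) :
  closure (cuboid u v) = cuboid u v.
Proof.
apply/seteqP; split; last exact: subset_closure.
move=> p clp i.
have near e : 0 < e ->
    exists2 q : 'rV[R]_l, cuboid u v q & `|p 0 i - q 0 i| < e.
  move=> e0; have [q [uvq [_ pq]]] := clp _ (nbhsx_ballx p e e0).
  by exists q => //; exact: pq.
rewrite !leNgt; apply/andP; split; apply/negP => lt.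
  (* The radius is the distance to the violated bound, so no point of the cuboid is that close. *)
  have [|q uvq] := near (u 0 i - p 0 i); first by rewrite subr_gt0.
  by have /andP[? _] := uvq i; rewrite ltr_norml => /andP[? ?]; lra.
have [|q uvq] := near (p 0 i - v 0 i); first by rewrite subr_gt0.
by have /andP[_ ?] := uvq i; rewrite ltr_norml => /andP[? ?]; lra.
Qed.

Lemma placed_box_lattice (R : realType) (l : nat) (a p : 'rV[int]_l)
    (x : 'rV[nat]_l) :
  placed_box R a x (lattice_point R p) <->
  forall i, a 0 i <= p 0 i <= a 0 i + (x 0 i)%:Z.
Proof.
(* A natural cast is convertible to the cast of the corresponding integer; this turns real
   inequalities into integer ones. *)
by split=> h i; have := h i; rewrite !mxE -[(x 0 i)%:R]/((x 0 i)%:Z%:~R)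
  -intrD !ler_int.
Qed.

Lemma boundary_lattice (R : realType) (l : nat) (a p : 'rV[int]_l)
    (x : 'rV[nat]_l) :
  boundary (placed_box R a x) (lattice_point R p) <->
  (forall i, a 0 i <= p 0 i <= a 0 i + (x 0 i)%:Z) /\
  exists i, p 0 i = a 0 i \/ p 0 i = a 0 i + (x 0 i)%:Z.
Proof.
rewrite /boundary closure_cuboid interior_cuboid /=.
split=> [[/placed_box_lattice pin pNint]|[pin [i pi]]].
  split=> //; apply: contra_notP pNint => pNext i.
  rewrite !mxE -[(x 0 i)%:R]/((x 0 i)%:Z%:~R) -intrD !ltr_int.
  have /andP[ge le] := pin i.
  rewrite !lt_neqAle ge le !andbT eq_sym.
  by apply/andP; split; apply/eqP => eq; apply: pNext; exists i; auto.
split; first exact/placed_box_lattice.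
move=> /(_ i); rewrite !mxE -[(x 0 i)%:R]/((x 0 i)%:Z%:~R) -intrD !ltr_int.
by case: pi => ->; rewrite ltxx ?andbF.
Qed.

(** * Attachments and bounding boxes in integer coordinates *)

(** A common lattice point bounds every coordinate of [t], and disjointness of the interiors forces
    some coordinate to an end of its range. *)
Lemma attachmentsE (R : realType) (l : nat) (x y : 'rV[nat]_l) :
  (forall i, (0 < x 0%R i)%N) -> (forall i, (0 < y 0%R i)%N) ->
  attachments R x y =
  [set t | (forall i, - (y 0 i)%:Z <= t 0 i <= (x 0 i)%:Z) /\
           exists i, t 0 i = - (y 0 i)%:Z \/ t 0 i = (x 0 i)%:Z].
Proof.
move=> x_gt0 y_gt0; apply/seteqP; split=> t /=.
  move=> [disj [p [/boundary_lattice[p0 _] /boundary_lattice[pt _]]]].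
  have tin i : - (y 0 i)%:Z <= t 0 i <= (x 0 i)%:Z.
    by have := p0 i; have := pt i; rewrite mxE; lia.
  split=> //; apply: contrapT => tNext.
  have tlt i : - (y 0 i)%:Z < t 0 i < (x 0 i)%:Z.
    have /andP[ge le] := tin i; rewrite !lt_neqAle ge le !andbT eq_sym.
    by apply/andP; split; apply/eqP => eq; apply: tNext; exists i; auto.
  (* The overlap of the two intervals starts at [c i] and has integer length at least 1, so
     [c i + 1 / 2] is interior to both. *)
  pose c i := Num.max 0 (t 0 i).
  have cin i : [/\ 0 <= c i, c i + 1 <= (x 0 i)%:Z, t 0 i <= c i &
      c i + 1 <= t 0 i + (y 0 i)%:Z].
    by have := tlt i; have := x_gt0 i; have := y_gt0 i; rewrite /c; split; lia.
  suff : set0 (\row_i ((c i)%:~R + 1 / 2) : 'rV[R]_l) by [].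
  rewrite -disj; split; rewrite /placed_box interior_cuboid /= => i;
    rewrite !mxE;
    have [c0 cx ct cy] := cin i;
    rewrite -?[(x 0 i)%:R]/((x 0 i)%:Z%:~R) -?[(y 0 i)%:R]/((y 0 i)%:Z%:~R).
    have : (0 : int)%:~R <= (c i)%:~R :> R by rewrite ler_int.
    have : (c i + 1)%:~R <= (x 0 i)%:Z%:~R :> R by rewrite ler_int.
    by rewrite intrD => ? ?; apply/andP; split; lra.
  have : (t 0 i)%:~R <= (c i)%:~R :> R by rewrite ler_int.
  have : (c i + 1)%:~R <= (t 0 i + (y 0 i)%:Z)%:~R :> R by rewrite ler_int.
  by rewrite !intrD => ? ?; apply/andP; split; lra.
move=> [tin [i ti]]; split.
  rewrite /placed_box !interior_cuboid; apply/seteqP; split=> // p [/= px py].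
  have := px i; have := py i; rewrite !mxE.
  by case: ti => ->; rewrite ?intrN -?pmulrn => /andP[? ?] /andP[? ?]; lra.
(* In the extreme direction [i] this point is at [x 0 i] if [t 0 i] is [x 0 i], and at 0 otherwise:
   in both cases on a face of each box. *)
exists (\row_j Num.max 0 (t 0 j)); split; apply/boundary_lattice; split.
- by move=> j; have := tin j; rewrite !mxE; lia.
- by exists i; rewrite !mxE; lia.
- by move=> j; have := tin j; rewrite !mxE; lia.
- by exists i; rewrite !mxE; lia.
Qed.

(** The bounding box has least vertex [lo] and greatest vertex [hi]. Inclusions between boxes are
    tested on two opposite vertices. *)
Lemma aggregates_toE (R : realType) (l : nat) (x y z : 'rV[nat]_l)
    (t : 'rV[int]_l) :
  aggregates_to R x y t z <->
  forall i, (z 0 i)%:Z =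
    Num.max (x 0 i)%:Z (t 0 i + (y 0 i)%:Z) - Num.min 0 (t 0 i).
Proof.
pose lo := \row_i Num.min 0 (t 0 i).
pose hi := \row_i Num.max (x 0 i)%:Z (t 0 i + (y 0 i)%:Z).
have subset_lohi : placed_box R 0 x `|` placed_box R t y `<=`
    cuboid (lattice_point R lo) (lattice_point R hi).
  have int_le (m n : int) : m <= n -> m%:~R <= n%:~R :> R by rewrite ler_int.
  move=> p [] pin i; have /andP[] := pin i; rewrite !mxE.
    have /int_le : Num.min 0 (t 0 i) <= 0 by lia.
    have /int_le :
      (x 0 i)%:Z <= Num.max (x 0 i)%:Z (t 0 i + (y 0 i)%:Z) by lia.
    rewrite -[(x 0 i)%:R]/((x 0 i)%:Z%:~R) => ? ? ? ?.
    by apply/andP; split; lra.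
  have /int_le : Num.min 0 (t 0 i) <= t 0 i by lia.
  have /int_le : t 0 i + (y 0 i)%:Z <=
    Num.max (x 0 i)%:Z (t 0 i + (y 0 i)%:Z) by lia.
  rewrite intrD -[(y 0 i)%:R]/((y 0 i)%:Z%:~R) => ? ? ? ?.
  by apply/andP; split; lra.
have corner (a : 'rV[int]_l) (w : 'rV[nat]_l) :
    placed_box R a w (lattice_point R a).
  by apply/placed_box_lattice => i; lia.
have corner' (a : 'rV[int]_l) (w : 'rV[nat]_l) :
    placed_box R a w (lattice_point R (\row_i (a 0 i + (w 0 i)%:Z))).
  by apply/placed_box_lattice => i; rewrite mxE; lia.
split=> [[a [sub minz]]|zE].
  move=> i.
  have /placed_box_lattice/(_ i) := sub _ (or_introl (corner 0 x)).
  have /placed_box_lattice/(_ i) := sub _ (or_introl (corner' 0 x)).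
  have /placed_box_lattice/(_ i) := sub _ (or_intror (corner t y)).
  have /placed_box_lattice/(_ i) := sub _ (or_intror (corner' t y)).
  (* Minimality is applied to the competitor spanned by [lo] and [hi]. *)
  have /(_ _ (corner a z) i) := minz _ _ subset_lohi.
  have /(_ _ (corner' a z) i) := minz _ _ subset_lohi.
  by rewrite !mxE !ler_int; lia.
exists lo; split=> [p /subset_lohi pin i|u v sub p pin i].
  have := pin i; rewrite !mxE -[(z 0 i)%:R]/((z 0 i)%:Z%:~R) zE -intrD.
  by rewrite [_ + (_ - _)]addrC subrK.
have /andP[] := pin i; rewrite !mxE -[(z 0 i)%:R]/((z 0 i)%:Z%:~R) zE -intrD.
rewrite [_ + (_ - _)]addrC subrK.
have /(_ i)/andP[] := sub _ (or_introl (corner 0 x)).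
have /(_ i)/andP[] := sub _ (or_introl (corner' 0 x)).
have /(_ i)/andP[] := sub _ (or_intror (corner t y)).
have /(_ i)/andP[] := sub _ (or_intror (corner' t y)).
rewrite !mxE -?pmulrn => _ yv uy _ _ xv ux _ uz zv; apply/andP; split.
  by apply: le_trans uz; rewrite minEle; case: ifP.
apply: (le_trans zv); rewrite maxEle; case: ifP => // _.
Qed.

(** * Positions of the unit box and their results *)

(** Transfers the count to a finite type, where cardinalities of families of functions are
    products. *)
Lemma card_fset_set_image (T : finType) (U : choiceType) (f : T -> U)
    (P : pred T) :
  injective f -> #|` fset_set [set f s | s in [set s | P s]]| = #|P|.
Proof.
move=> f_inj; rewrite fset_set_image //; last exact: finite_finset.
rewrite card_imfset //= cardE; apply/perm_size/uniq_perm.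
- exact: fset_uniq.
- exact: enum_uniq.
- move=> s; rewrite in_fset_set; last exact: finite_finset.
  by rewrite mem_enum; apply/idP/idP; rewrite inE.
Qed.

Definition grown {l : nat} (x : 'rV[nat]_l) (I : {set 'I_l}) : 'rV[nat]_l :=
  x + \sum_(i in I) delta_mx 0 i.

Lemma grownE (l : nat) (x : 'rV[nat]_l) (I : {set 'I_l}) i :
  grown x I 0 i = (x 0%R i + (i \in I))%N.
Proof.
rewrite !mxE summxE; congr (_ + _)%N.
under eq_bigr do rewrite mxE eqxx /=.
case: (boolP (i \in I)) => iI.
  rewrite (bigD1 i) //= eqxx big1 ?addr0 // => j /andP[_].
  by rewrite eq_sym => /negPf ->.
rewrite big1 // => j jI; case: eqVneq => // ij.
by rewrite ij jI in iI.
Qed.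

Lemma grown_inj (l : nat) (x : 'rV[nat]_l) : injective (grown x).
Proof.
move=> I J IJ; apply/setP => i; have := congr1 (fun z : 'rV_l => z 0 i) IJ.
by rewrite !grownE => /addnI; do 2 case: (_ \in _).
Qed.

Lemma growth_grown (l : nat) (x : 'rV[nat]_l) (I : {set 'I_l}) :
  growth x (grown x I) = #|I|.
Proof.
apply: eq_card => i; apply/idP/idP; rewrite inE /= grownE.
  by case: (_ \in _); rewrite ?addn0 ?eqxx.
by move=> ->; rewrite addn1 gtn_eqF.
Qed.

(* The unit box at a position [f] has its least vertex at [f - 1]; the positions
   with no extreme coordinate are those inside [x]. *)
Definition position {l : nat} (x : 'rV[nat]_l) :=
  {dffun forall i, 'I_(x 0 i).+2}.

Definition translation {l : nat} {x : 'rV[nat]_l} (f : position x) :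
    'rV[int]_l :=
  \row_i ((f i : nat)%:Z - 1).

(** The values [ord0] and [ord_max] stand for the translations -1 and [x 0 i], at which the unit box
    sticks out of [x]. *)
Definition protruding {l : nat} {x : 'rV[nat]_l} (f : position x) :
    {set 'I_l} :=
  [set i | (f i == ord0) || (f i == ord_max)]%SET.

Lemma translation_inj (l : nat) (x : 'rV[nat]_l) : injective (@translation l x).
Proof.
move=> f g fg; apply/ffunP => i; apply: val_inj.
by have := congr1 (fun t : 'rV_l => t 0 i) fg; rewrite !mxE => /addIr [].
Qed.

(** In each direction the unit interval either lies within that of [x] or extends it by 1, the
    latter exactly at an extreme value of [f]. *)
Lemma aggregates_to_grown (R : realType) (l : nat) (x : 'rV[nat]_l)
    (f : position x) (z : 'rV[nat]_l) :
  aggregates_to R x (const_mx 1%N) (translation f) z <->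
  z = grown x (protruding f).
Proof.
have E i : (grown x (protruding f) 0 i)%:Z =
    Num.max (x 0 i)%:Z (translation f 0 i + ((const_mx 1%N : 'rV_l) 0 i)%:Z) -
    Num.min 0 (translation f 0 i).
  rewrite grownE inE -!val_eqE /= !mxE.
  by have := ltn_ord (f i); lia.
rewrite aggregates_toE; split=> [zE|-> //].
by apply/rowP => i; have := zE i; rewrite -E => -[].
Qed.

Lemma attachments_unit (R : realType) (l : nat) (x : 'rV[nat]_l) :
  (forall i, (0 < x 0%R i)%N) ->
  attachments R x (const_mx 1%N) =
  @translation l x @` [set f : position x | (0 < #|protruding f|)%N].
Proof.
move=> x_gt0; rewrite attachmentsE //; last by move=> i; rewrite mxE.
apply/seteqP; split=> t /=.
  move=> [tin [i ti]].
  (* The shifted coordinate is nonnegative, so the absolute value only converts it to a natural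
     number. *)
  have ft (j : 'I_l) : (`|(t 0%R j + 1)%R| < (x 0%R j).+2)%N.
    by have := tin j; rewrite mxE; lia.
  exists [ffun j => Ordinal (ft j)].
    apply/card_gt0P; exists i; rewrite inE -!val_eqE /= ffunE /=.
    by move: ti; rewrite mxE; lia.
  by apply/rowP => j; rewrite !mxE ffunE /=; have := tin j; rewrite mxE; lia.
move=> [f /card_gt0P[i]]; rewrite inE -!val_eqE /= => fi <-; split.
  by move=> j; have := ltn_ord (f j); rewrite !mxE; lia.
by exists i; rewrite !mxE; lia.
Qed.

(** * Counting positions by protruding directions *)

(** The condition is independent in each coordinate: two extreme values for [i] in [I], the
    remaining [x 0 i] values otherwise. *)
Lemma card_protruding (l : nat) (x : 'rV[nat]_l) (I : {set 'I_l}) :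
  #|[pred f : position x | protruding f == I]| =
  (\prod_i if i \in I then 2 else x 0%R i)%N.
Proof.
pose F i := [pred k : 'I_(x 0%R i).+2 |
  ((k == ord0) || (k == ord_max)) == (i \in I)].
have -> : #|[pred f : position x | protruding f == I]| =
    #|(family F : simpl_pred (position x))|.
  apply: eq_card => f; rewrite !inE; apply/eqP/familyP => [fI i|fF].
    by rewrite !inE -fI inE.
  by apply/setP => i; have := fF i; rewrite !inE => /eqP.
rewrite card_family foldrE big_map big_enum /=; apply: eq_bigr => i _.
have two : #|[set ord0; ord_max : 'I_(x 0%R i).+2]%SET| = 2 by rewrite cards2.
case: (i \in I).
  by rewrite -[RHS]two; apply: eq_card => k; rewrite !inE -topredE /= eqb_id.
have := cardsC [set ord0; ord_max : 'I_(x 0%R i).+2]%SET.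
rewrite two card_ord -add2n => /addnI xE.
by rewrite -[RHS]xE; apply: eq_card => k; rewrite !inE -topredE /= eqbF_neg.
Qed.

(** The positions discarded from the full product are those with no protruding direction, counted by
    the case of the empty set. *)
Lemma card_attached (l : nat) (x : 'rV[nat]_l) :
  (#|[pred f : position x | (0 < #|protruding f|)%N]| =
   \prod_i (x 0%R i).+2 - \prod_i x 0%R i)%N.
Proof.
have := cardC [pred f : position x | protruding f == finset.set0].
rewrite card_protruding card_dep_ffun foldrE big_map big_enum /=.
under eq_bigr do rewrite inE.
under [in RHS]eq_bigr do rewrite card_ord.
move=> <-; rewrite addKn; apply: eq_card => f.
by rewrite !inE card_gt0.
Qed.

Lemma card_leq_dim {l : nat} (I : {set 'I_l}) : (#|I| <= l)%N.
Proof. by rewrite -[X in (_ <= X)%N]card_ord max_card. Qed.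

Lemma prod_if_in (R : comPzRingType) (T : finType) (I : {set T}) (c : R)
    (F : T -> R) :
  \prod_i (if i \in I then c else F i) = c ^+ #|I| * \prod_(i in ~: I) F i.
Proof.
rewrite (bigID (mem I)) /=; congr (_ * _).
  by rewrite -prodr_const; apply: eq_bigr => i ->.
by apply: eq_big => i; rewrite ?inE // => /negPf ->.
Qed.

(** * Probabilities and mean for the unit box *)

Lemma finite_attachments_unit (R : realType) (l : nat) (x : 'rV[nat]_l) :
  (forall i, (0 < x 0%R i)%N) -> finite_set (attachments R x (const_mx 1%N)).
Proof.
by move=> x_gt0; rewrite attachments_unit //; apply: finite_image;
  exact: finite_finset.
Qed.

Lemma nb_attachments_unit (R : realType) (l : nat) (x : 'rV[nat]_l) :
  (forall i, (0 < x 0%R i)%N) ->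
  (nb_attachments R x (const_mx 1%N))%:R =
  \prod_i ((x 0 i)%:R + 2) - \prod_i (x 0 i)%:R :> R.
Proof.
move=> x_gt0; rewrite /nb_attachments attachments_unit // card_fset_set_image;
  last exact: translation_inj.
(* Truncated subtraction agrees with ring subtraction here, the products being compared factor by
   factor. *)
rewrite card_attached natrB; last by apply: leq_prod => i _; exact: leqW.
rewrite !natr_prod; congr (_ - _); apply: eq_bigr => i _.
by rewrite -addn2 natrD.
Qed.

Lemma transition_prob_grown (R : realType) (l : nat) (x : 'rV[nat]_l)
    (I : {set 'I_l}) :
  (forall i, (0 < x 0%R i)%N) -> (0 < #|I|)%N ->
  transition_prob R x (const_mx 1%N) (grown x I) =
  \prod_i (if i \in I then 2 else (x 0 i)%:R) /
  (nb_attachments R x (const_mx 1%N))%:R.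
Proof.
move=> x_gt0 I_gt0; rewrite /transition_prob attachments_unit //.
have -> : @translation l x @` [set f : position x | (0 < #|protruding f|)%N] `&`
    [set t | aggregates_to R x (const_mx 1%N) t (grown x I)] =
    @translation l x @` [set f : position x | protruding f == I].
  apply/seteqP; split=> t /=.
    by move=> [[f _ <-] /aggregates_to_grown/grown_inj/esym/eqP]; exists f.
  (* Nonemptiness of [I] makes the position an attachment. *)
  move=> [f /eqP fI <-]; split; first by exists f; rewrite ?fI.
  by apply/aggregates_to_grown; rewrite fI.
rewrite (card_fset_set_image _ _ _ [pred f : position x | protruding f == I]);
  last exact: translation_inj.
rewrite card_protruding natr_prod; congr (_ / _).
by apply: eq_bigr => i _; case: ifP.
Qed.

Lemma results_unit (R : realType) (l : nat) (x : 'rV[nat]_l) :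
  (forall i, (0 < x 0%R i)%N) ->
  results R x (const_mx 1%N) = grown x @` [set I : {set 'I_l} | (0 < #|I|)%N].
Proof.
move=> x_gt0; apply/seteqP; split=> z /=.
  move=> [t]; rewrite attachments_unit // => -[f /= f_gt0 <-].
  by move=> /aggregates_to_grown ->; exists (protruding f).
move=> [I I_gt0 <-].
have [f fI] : exists f : position x, protruding f = I.
  (* Outside [I] the value 1, that is translation 0, is not the last one [x 0 i + 1] because [x 0 i]
     is positive. *)
  exists [ffun i => if i \in I then ord0 else inord 1]; apply/setP => i.
  rewrite inE -!val_eqE /= ffunE; case: (i \in I) => //=.
  by rewrite inordK //; have := x_gt0 i; lia.
exists (translation f); last by apply/aggregates_to_grown; rewrite fI.
by rewrite attachments_unit //; exists f; rewrite //= fI.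
Qed.

(** Injectivity of [grown] reindexes sums over results by nonempty sets of directions. *)
Lemma sum_results (R : realType) (l : nat) (x : 'rV[nat]_l)
    (P : set 'rV[nat]_l) (Q : pred {set 'I_l})
    (F : 'rV[nat]_l -> R) :
  (forall i, (0 < x 0%R i)%N) ->
  (forall I : {set 'I_l}, (0 < #|I|)%N -> P (grown x I) <-> Q I) ->
  \sum_(z \in results R x (const_mx 1%N) `&` P) F z =
  \sum_(I : {set 'I_l} | (0 < #|I|)%N && Q I) F (grown x I).
Proof.
move=> x_gt0 PQ; rewrite results_unit //.
have -> : grown x @` [set I : {set 'I_l} | (0 < #|I|)%N] `&` P =
    grown x @` [set I : {set 'I_l} | (0 < #|I|)%N && Q I].
  apply/seteqP; split=> z /=.
    by move=> [[I I_gt0 <-] /(PQ I I_gt0) QI]; exists I; rewrite //= I_gt0.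
  move=> [I /andP[I_gt0 QI] <-]; split; first by exists I.
  exact/PQ.
rewrite fsbig_image; last by move=> I J _ _; exact: grown_inj.
rewrite -[RHS]big_filter [RHS]fsbig_seq ?filter_uniq ?index_enum_uniq //.
apply: eq_fsbigl; apply/seteqP; split=> I /=;
  by rewrite mem_filter mem_index_enum andbT.
Qed.

Lemma growth_prob_unit (R : realType) (l : nat) (x : 'rV[nat]_l) (k : nat) :
  (forall i, (0 < x 0%R i)%N) -> (1 <= k <= l)%N ->
  growth_prob R x (const_mx 1%N) k =
  2 ^+ k * (esym_poly (l - k) x)%:R / (nb_attachments R x (const_mx 1%N))%:R.
Proof.
move=> x_gt0 /andP[k_gt0 k_le].
rewrite /growth_prob (sum_results _ _ _ _ (fun I => #|I| == k)) //; last first.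
  by move=> I _; rewrite /= growth_grown; split=> /eqP.
have -> : 2 ^+ k * (esym_poly (l - k) x)%:R =
    \sum_(I : {set 'I_l} | (0 < #|I|)%N && (#|I| == k))
      \prod_i (if i \in I then 2 else (x 0 i)%:R) :> R.
  rewrite /esym_poly natr_sum mulr_sumr.
  (* The factors [x 0 i] come from the directions without growth, so the index set of the symmetric
     polynomial is the complement of [I]. *)
  rewrite (reindex_inj (inv_inj (@finset.setCK _))) /=.
  apply: eq_big => [I|I].
    rewrite cardsCs finset.setCK card_ord.
    have := card_leq_dim I; move: #|I| => n nl.
    (* Both [#|I|] and [k] are at most [l], so the truncated differences determine them; [k_gt0]
       gives nonemptiness. *)
    by apply/eqP/andP => [eq|[_ /eqP ->] //]; split; lia.
  rewrite cardsCs finset.setCK card_ord => /eqP Ik.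
  rewrite prod_if_in natr_prod; congr (_ ^+ _ * _).
  by move: Ik (card_leq_dim I); move: #|I| => n; lia.
rewrite mulr_suml; apply: eq_bigr => I /andP[I_gt0 _].
exact: transition_prob_grown.
Qed.

(** Linearity of expectation: [#|I|] is a sum of indicators over directions, and [A] factors out of
    both the numerator and the number of attachments. *)
Lemma growth_mean_unit (R : realType) (l : nat) (x : 'rV[nat]_l) :
  (forall i, (0 < x 0%R i)%N) ->
  growth_mean R x (const_mx 1%N) =
  (\sum_i 2 / (2 + (x 0 i)%:R)) /
  (1 - \prod_i ((x 0 i)%:R / ((x 0 i)%:R + 2))).
Proof.
move=> x_gt0.
pose w (I : {set 'I_l}) : R :=
  \prod_i (if i \in I then 2 else (x 0 i)%:R).
pose A : R := \prod_i ((x 0 i)%:R + 2).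
have x2_neq0 i : (x 0 i)%:R + 2 != 0 :> R by rewrite -natrD pnatr_eq0 addn2.
have A_neq0 : A != 0 by apply/prodf_neq0 => i _.
have -> : growth_mean R x (const_mx 1%N) =
    (\sum_(I : {set 'I_l}) #|I|%:R * w I) /
    (nb_attachments R x (const_mx 1%N))%:R.
  rewrite /growth_mean -[X in \sum_(_ \in X) _]setIT.
  rewrite (sum_results _ _ _ _ xpredT) //.
  rewrite [in RHS](bigID (fun I : {set 'I_l} => (0 < #|I|)%N)) /=.
  (* The empty set, which is no result, can be added to the sum since its weight [#|I|] is 0. *)
  rewrite [X in (_ + X) / _]big1 ?addr0.
    rewrite mulr_suml; apply: eq_big => [I|I]; first by rewrite andbT.
    rewrite andbT => I_gt0.
    by rewrite growth_grown transition_prob_grown // mulrA.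
  by move=> I; rewrite -eqn0Ngt => /eqP ->; rewrite mul0r.
have through i : \sum_(I : {set 'I_l} | i \in I) w I =
    A * (2 / (2 + (x 0 i)%:R)).
  (* Replacing [x 0 i] by 0 in the product kills, after expansion, exactly the terms of the sets
     that miss [i]. *)
  have -> : A * (2 / (2 + (x 0 i)%:R)) =
      \prod_j (2 + (if j == i then 0 else (x 0 j)%:R)).
    rewrite /A (bigD1 i) //= [RHS](bigD1 i) //= eqxx addr0.
    under [in RHS]eq_bigr => j /negPf ji do rewrite ji addrC.
    by rewrite [2 + _]addrC mulrACA [2 * _]mulrC; field.
  rewrite bigA_distr [RHS](bigID (fun I : {set 'I_l} => i \in I)) /=.
  rewrite [X in _ + X]big1 ?addr0.
    apply: eq_bigr => I iI; apply: eq_bigr => j _; case: ifP => // jI.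
    by case: eqVneq => // ji; rewrite ji iI in jI.
  by move=> I iI; rewrite (bigD1 i) //= (negPf iI) eqxx mul0r.
have -> : \sum_(I : {set 'I_l}) #|I|%:R * w I = A * \sum_i 2 / (2 + (x 0 i)%:R).
  under eq_bigr => I _ do rewrite -sumr_const mulr_suml big_mkcond /=.
  rewrite exchange_big mulr_sumr; apply: eq_bigr => i _.
  rewrite -through [RHS]big_mkcond; apply: eq_bigr => I _.
  by case: ifP; rewrite ?mul1r.
have -> : (nb_attachments R x (const_mx 1%N))%:R =
    A * (1 - \prod_i ((x 0 i)%:R / ((x 0 i)%:R + 2))).
  rewrite nb_attachments_unit // mulrBr mulr1; congr (_ - _).
  by rewrite -big_split; apply: eq_bigr => i _ /=; rewrite mulrC divfK.
by rewrite -mulf_div divff ?mul1r.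
Qed.

Theorem proposition5p1 (R : realType) (l : nat) (x : 'rV[nat]_l)
    (l_ge1 : (1 <= l)%N) (x_gt0 : forall i, (0 < x 0%R i)%N) :
  let one : 'rV[nat]_l := const_mx 1%N in
  let T : R := (nb_attachments R x one)%:R in
  [/\ finite_set (attachments R x one) /\
      T = \prod_(i < l) ((x 0 i)%:R + 2) - \prod_(i < l) (x 0 i)%:R,
      (forall z : 'rV[nat]_l, results R x one z ->
        exists2 I : {set 'I_l}, (1 <= #|I| <= l)%N &
          z = x + \sum_(i in I) delta_mx 0 i) /\
      (forall I : {set 'I_l}, (1 <= #|I| <= l)%N ->
        transition_prob R x one (x + \sum_(i in I) delta_mx 0 i) =
          (2 ^+ #|I| * \prod_(i < l) (x 0 i)%:R) /
          (\prod_(i in I) (x 0 i)%:R * T)),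
      forall k : nat, (1 <= k <= l)%N ->
        growth_prob R x one k = 2 ^+ k * (esym_poly (l - k) x)%:R / T
    & growth_mean R x one =
        (\sum_(i < l) 2 / (2 + (x 0 i)%:R)) /
        (1 - \prod_(i < l) ((x 0 i)%:R / ((x 0 i)%:R + 2)))].
Proof.
move=> one T; split.
- by split; [exact: finite_attachments_unit|exact: nb_attachments_unit].
- split=> [z|I /andP[I_gt0 _]].
    rewrite results_unit // => -[I I_gt0 <-]; exists I => //.
    by rewrite I_gt0 card_leq_dim.
  rewrite -/(grown x I) transition_prob_grown // prod_if_in.
  (* The product over [I] is nonzero by positivity and cancels, leaving the product over the
     complement. *)
  rewrite [in RHS](bigID (mem I)) /= mulrCA -mulf_div divff ?mul1r.
    by congr (_ * _ / _); apply: eq_bigl => i; rewrite inE.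
  by apply/prodf_neq0 => i _; rewrite pnatr_eq0 -lt0n.
- by move=> k; exact: growth_prob_unit.
- exact: growth_mean_unit.
Qed.
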